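(* The optimality conditions $$I_1(a^\ast,b^\ast):=\int_{a^\ast}^{b^\ast}(\pi_1(t)-\pi_1(b^\ast))m'(t)\,dt+\frac{q_d+q_u}{S'(a^\ast)}=0,$$ $$I_2(a^\ast,b^\ast):=\int_{a^\ast}^{b^\ast}(\pi_2(t)-\pi_2(a^\ast))m'(t)\,dt+\frac{q_d+q_u}{S'(b^\ast)}=0$$ have a uniquely determined solution $(a^\ast,b^\ast)\in(-\infty,\hat x_2)\times(\hat x_1,\infty)$. Especially, $$C(a^\ast,b^\ast)=\lambda^\ast=\pi_2(a^\ast)=\pi_1(b^\ast).$$ Moreover, the marginal value $v'(x)$ satisfies the inequality $-q_u\le v'(x)\le q_d$ for all $x\in\mathbb{R}$.
   Context: Setting. $\mu:\mathbb{R}\to\mathbb{R}$ is continuous; $\sigma:\mathbb{R}\to\mathbb{R}_+$ is continuous with $\sigma^2(x)>0$ for all $x\in\mathbb{R}$, and $x\mapsto(1+|\mu(x)|)/\sigma^2(x)$ is locally integrable on $\mathbb{R}$. Put $\mathcal{A}=\frac12\sigma^2(x)\frac{d^2}{dx^2}+\mu(x)\frac{d}{dx}$, $S'(x)=\exp\left(-\int^x\frac{2\mu(y)}{\sigma^2(y)}dy\right)$ (arbitrary fixed lower limit of integration; density of the scale), $m'(x)=\frac{2}{\sigma^2(x)S'(x)}$ (density of the speed measure), $m(a,b)=\int_a^b m'(t)\,dt$. Costs. $c:\mathbb{R}\to\mathbb{R}_+$ is continuous with $c(x)\ge c(0)\ge0$ for all $x\in\mathbb{R}$, and $q_u,q_d\in\mathbb{R}_+$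 are constants. Put $\pi_1(x)=c(x)+q_d\mu(x)$ and $\pi_2(x)=c(x)-q_u\mu(x)$. Standing assumptions: (i) for $i=1,2$ there is a unique $\hat x_i=\operatorname{argmin}\{\pi_i(x)\}\in\mathbb{R}$ so that $\pi_i$ is decreasing on $(-\infty,\hat x_i)$ and increasing on $(\hat x_i,\infty)$; (ii) $\lim_{x\uparrow\infty}\pi_1(x)=\lim_{x\downarrow-\infty}\pi_2(x)=\infty$. For $a<b$, the expected long-run average cost of reflecting the diffusion with generator $\mathcal{A}$ at $a$ (upwards, unit cost $q_u$) and $b$ (downwards, unit cost $q_d$) with running cost $c$ is $$C(a,b)=\frac{1}{m(a,b)}\left[\int_a^b c(t)m'(t)\,dt+\frac{q_u}{S'(a)}+\frac{q_d}{S'(b)}\right].$$ Free boundary problem: determine a twice continuously differentiable function $v:\mathbb{R}\to\mathbb{R}_+$, two boundaries $a<0<b$ and a parameter $\lambda\in\mathbb{R}_+$ such that $(\mathcal{A}v)(x)+c(x)=\lambda$ for $x\in(a,b)$, $v(x)=q_d(x-b)+v(b)$ for $x\in[b,\infty)$, and $v(x)=q_u(a-x)+v(a)$ for $x\in(-\infty,a]$. For given boundaries this forces $\lambda=C(a,b)$, and $v''(a)=v''(b)=0$ gives $\lambda=\pi_1(b)=\pi_2(a)$. In the claim, $v$ and $\lambda^\ast$ are the function and the parameter of this problem for the boundaries $a=a^\ast$, $b=b^\ast$.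
   Formalization: The costs q_u, q_d ≥ 0 are assumed not both zero (for q_u = q_d = 0 the optimality conditions have no solution), and the solution (a*, b* ) is sought and unique among pairs with a* < b*, since oriented integrals can give further roots with b < a. *)

(* Defs.v *)
(* Stdlib's real numbers with Coquelicot's integrals, derivatives and limits. *)
From Stdlib Require Import Reals.
From Coquelicot Require Import Coquelicot.
Open Scope R_scope.

(* The generator (1/2) sigma^2 d^2/dx^2 + mu d/dx. *)
Definition generator (mu sigma v : R -> R) (x : R) : R :=
  / 2 * (sigma x) ^ 2 * Derive (Derive v) x + mu x * Derive v x.

(* S'; [x0] is the arbitrary fixed lower limit of integration. *)
Definition scale_density (mu sigma : R -> R) (x0 x : R) : R :=
  exp (- RInt (fun y => 2 * mu y / (sigma y) ^ 2) x0 x).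

(* m' *)
Definition speed_density (mu sigma : R -> R) (x0 x : R) : R :=
  2 / ((sigma x) ^ 2 * scale_density mu sigma x0 x).

Definition speed_measure (mu sigma : R -> R) (x0 a b : R) : R :=
  RInt (speed_density mu sigma x0) a b.

Definition pi1 (mu c : R -> R) (qd x : R) : R := c x + qd * mu x.
Definition pi2 (mu c : R -> R) (qu x : R) : R := c x - qu * mu x.

Definition is_unique_argmin (f : R -> R) (xhat : R) : Prop :=
  (forall y, f xhat <= f y) /\
  (forall z, (forall y, f z <= f y) -> z = xhat).

(* "Decreasing" and "increasing" are strict: a plateau of pi1 or pi2 away from
   its minimum could destroy the uniqueness of the optimal boundaries. *)
Definition decreasing_then_increasing (f : R -> R) (xhat : R) : Prop :=
  (forall x y, x < y < xhat -> f y < f x) /\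
  (forall x y, xhat < x < y -> f x < f y).

Definition average_cost (mu sigma c : R -> R) (qu qd x0 a b : R) : R :=
  / speed_measure mu sigma x0 a b *
  (RInt (fun t => c t * speed_density mu sigma x0 t) a b
   + qu / scale_density mu sigma x0 a + qd / scale_density mu sigma x0 b).

Definition I1 (mu sigma c : R -> R) (qu qd x0 a b : R) : R :=
  RInt (fun t => (pi1 mu c qd t - pi1 mu c qd b)
                 * speed_density mu sigma x0 t) a b
  + (qd + qu) / scale_density mu sigma x0 a.

Definition I2 (mu sigma c : R -> R) (qu qd x0 a b : R) : R :=
  RInt (fun t => (pi2 mu c qu t - pi2 mu c qu a)
                 * speed_density mu sigma x0 t) a b
  + (qd + qu) / scale_density mu sigma x0 b.

(* [a < b] is not implied by the other conditions: when xhat1 < xhat2, the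
   equations, read with oriented integrals, may have further roots with
   b < a. *)
Definition optimal_boundaries (mu sigma c : R -> R)
    (qu qd x0 xhat1 xhat2 a b : R) : Prop :=
  a < xhat2 /\ xhat1 < b /\ a < b /\
  I1 mu sigma c qu qd x0 a b = 0 /\ I2 mu sigma c qu qd x0 a b = 0.

Definition twice_continuously_differentiable (v : R -> R) : Prop :=
  forall x, ex_derive v x /\ ex_derive (Derive v) x /\
            continuous (Derive (Derive v)) x.

(* The free boundary problem for given boundaries [a < b]; the position of 0
   relative to [a] and [b] is left free. *)
Definition solves_free_boundary_problem (mu sigma c : R -> R) (qu qd a b : R)
    (v : R -> R) (lambda : R) : Prop :=
  twice_continuously_differentiable v /\
  (forall x, 0 <= v x) /\
  0 <= lambda /\
  (forall x, a < x < b -> generator mu sigma v x + c x = lambda) /\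
  (forall x, b <= x -> v x = qd * (x - b) + v b) /\
  (forall x, x <= a -> v x = qu * (a - x) + v a).

(* Main.v *)
(* Write g = 1/S' and let M and C be primitives of m' and c m'.  Since
   g' = mu m', the functions
     Phi_q (x) = lambda M(x) - C(x) - q g(x)
   satisfy Phi_q' = (lambda - (c + q mu)) m', and both I_1 and I_2 equal
   Phi_{-q_u}(a) - Phi_{q_d}(b), for lambda = pi_1(b) and lambda = pi_2(a)
   respectively.  For each lambda above the two minima let a(lambda) <= xhat2 and
   b(lambda) >= xhat1 be the points where pi_2 and pi_1 take the value lambda.  By
   the sign of Phi_q', this pair maximises Phi_{q_d}(b) - Phi_{-q_u}(a) over
   a <= xhat2, b >= xhat1, so the maximal value F(lambda) is a supremum of affine
   functions of lambda, the one attaining it having slope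
   M(b(lambda)) - M(a(lambda)).  Hence F is Lipschitz on compacts and strictly
   increasing as soon as a(lambda) < b(lambda), and it changes sign exactly once
   there.

   For a solution v of the free boundary problem, v' g has derivative
   (lambda - c) m', so (v' + q_u) g and (v' - q_d) g are increments of
   Phi_{-q_u} and Phi_{q_d}, whose signs follow from quasiconvexity of pi_1 and
   pi_2. *)
Require Import Defs.
From Stdlib Require Import Reals Lra IndefiniteDescription.
From Coquelicot Require Import Coquelicot.
Open Scope R_scope.

(** * Calculus on the real line *)

Lemma continuous_continuity_pt (f : R -> R) (x : R) :
  continuous f x -> continuity_pt f x.
Proof. intros H; now apply continuity_pt_filterlim. Qed.

Lemma is_derive_continuous (f : R -> R) (x l : R) :
  is_derive f x l -> continuous f x.
Proof. intros H; apply (ex_derive_continuous f x); now exists l. Qed.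

Lemma is_derive_RInt_continuous (f : R -> R) (x0 x : R) :
  (forall y, continuous f y) -> is_derive (fun y => RInt f x0 y) x (f x).
Proof.
intros Hf; apply is_derive_RInt with x0; [|apply Hf].
apply filter_forall; intros y; apply (RInt_correct f).
now apply (ex_RInt_continuous f).
Qed.

Lemma RInt_is_derive (f df : R -> R) (a b : R) :
  (forall x, is_derive f x (df x)) -> (forall x, continuous df x) ->
  RInt df a b = f b - f a.
Proof.
intros H Hc; apply (is_RInt_unique df).
now apply (is_RInt_derive f df).
Qed.

Lemma derive_ge0_nondecreasing (f df : R -> R) (a b : R) :
  (forall x, is_derive f x (df x)) -> a <= b ->
  (forall x, a <= x <= b -> 0 <= df x) -> f a <= f b.
Proof.
intros H Hab Hd.
destruct (MVT_gen f a b df) as [z [Hz E]].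
- intros x _; apply H.
- intros x _; apply continuous_continuity_pt, (is_derive_continuous f x (df x)), H.
- rewrite Rmin_left, Rmax_right in Hz by lra.
  pose proof (Hd z Hz); nra.
Qed.

Lemma derive_le0_nonincreasing (f df : R -> R) (a b : R) :
  (forall x, is_derive f x (df x)) -> a <= b ->
  (forall x, a <= x <= b -> df x <= 0) -> f b <= f a.
Proof.
intros H Hab Hd.
enough (- f a <= - f b) by lra.
apply (derive_ge0_nondecreasing (fun x => - f x) (fun x => - df x)).
- intros x; exact (is_derive_opp f x (df x) (H x)).
- exact Hab.
- intros x Hx; pose proof (Hd x Hx); lra.
Qed.

Lemma derive_gt0_increasing (f df : R -> R) (a b : R) :
  (forall x, is_derive f x (df x)) -> (forall x, 0 < df x) ->
  a < b -> f a < f b.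
Proof.
intros H Hd Hab.
destruct (MVT_gen f a b df) as [z [_ E]].
- intros x _; apply H.
- intros x _; apply continuous_continuity_pt, (is_derive_continuous f x (df x)), H.
- pose proof (Hd z); nra.
Qed.

(** Derivatives are compared on the open interval only: the equation for [v] and the piecewise
    formulas below are available strictly between the boundary points, and continuity carries the
    increments to the closed interval. *)
Lemma eq_derive_eq_increment (f h df : R -> R) (a b : R) :
  a <= b ->
  (forall x, a < x < b -> is_derive f x (df x)) ->
  (forall x, a < x < b -> is_derive h x (df x)) ->
  (forall x, a <= x <= b -> continuous f x) ->
  (forall x, a <= x <= b -> continuous h x) ->
  f b - f a = h b - h a.
Proof.
intros Hab Hf Hh Cf Ch.
destruct (MVT_gen (fun x => f x - h x) a b (fun _ => 0)) as [z [_ E]].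
- rewrite Rmin_left, Rmax_right by lra; intros x Hx.
  replace 0 with (df x - df x) by ring.
  exact (is_derive_minus f h x _ _ (Hf x Hx) (Hh x Hx)).
- rewrite Rmin_left, Rmax_right by lra; intros x Hx.
  apply continuous_continuity_pt, (continuous_minus f h x); auto.
- lra.
Qed.

(** The one-sided form with [y <= z] is what the comparison of gains at two levels delivers
    directly; it also covers [clamp]. *)
Lemma nondecreasing_lipschitz_continuous (f : R -> R) (K x : R) :
  (forall y z, y <= z -> f y <= f z <= f y + K * (z - y)) -> continuous f x.
Proof.
intros H.
assert (HK : 0 <= K) by (destruct (H 0 1); lra).
apply continuity_pt_filterlim; intros eps Heps.
(* [K + 1] instead of [K] keeps the quotient meaningful when [K = 0]. *)
exists (eps / (K + 1)); split; [apply Rdiv_lt_0_compat; lra|].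
intros y [_ Hy]; unfold dist in *; simpl in *; unfold Rdist in *.
assert (Hy' : Rabs (y - x) * (K + 1) < eps).
{ apply Rmult_lt_reg_r with (/ (K + 1)); [apply Rinv_0_lt_compat; lra|].
  rewrite Rmult_assoc, Rinv_r, Rmult_1_r by lra; exact Hy. }
destruct (Rle_or_lt x y) as [Hxy|Hxy].
- rewrite (Rabs_pos_eq (y - x)) in Hy' by lra.
  destruct (H x y Hxy); rewrite Rabs_pos_eq by lra; nra.
- rewrite (Rabs_left (y - x)) in Hy' by lra.
  destruct (H y x) as [H1 H2]; [lra|].
  rewrite Rabs_left1 by lra; nra.
Qed.

(** Carries the value of [v'] from outside the interval to the boundary points, where the affine
    formulas for [v] hold on one side only. *)
Lemma continuous_adherent_value (f : R -> R) (a k : R) :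
  continuous f a ->
  (forall d, 0 < d -> exists x, Rabs (x - a) < d /\ f x = k) -> f a = k.
Proof.
intros Hf Hk.
destruct (Req_dec (f a) k) as [E|E]; [exact E|exfalso].
assert (He : 0 < Rabs (k - f a)) by (apply Rabs_pos_lt; lra).
destruct (proj1 (filterlim_locally f (f a)) Hf (mkposreal _ He)) as [d Hd].
destruct (Hk d (cond_pos d)) as [x [Hx Ex]].
specialize (Hd x Hx); rewrite Ex in Hd.
exact (Rlt_irrefl _ Hd).
Qed.

(** * Truncation to an interval *)

Definition clamp (lo hi x : R) : R := Rmax lo (Rmin hi x).

Lemma clamp_bounds (lo hi x : R) : lo <= hi -> lo <= clamp lo hi x <= hi.
Proof. intros H; unfold clamp, Rmax, Rmin; repeat destruct Rle_dec; lra. Qed.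

Lemma clamp_id (lo hi x : R) : lo <= x <= hi -> clamp lo hi x = x.
Proof. intros H; unfold clamp, Rmax, Rmin; repeat destruct Rle_dec; lra. Qed.

Lemma clamp_left (lo hi x : R) : x <= lo <= hi -> clamp lo hi x = lo.
Proof. intros H; unfold clamp, Rmax, Rmin; repeat destruct Rle_dec; lra. Qed.

Lemma clamp_right (lo hi x : R) : lo <= hi <= x -> clamp lo hi x = hi.
Proof. intros H; unfold clamp, Rmax, Rmin; repeat destruct Rle_dec; lra. Qed.

Lemma clamp_lipschitz (lo hi x y : R) :
  x <= y -> clamp lo hi x <= clamp lo hi y <= clamp lo hi x + 1 * (y - x).
Proof. intros H; unfold clamp, Rmax, Rmin; repeat destruct Rle_dec; lra. Qed.

(** * Unimodal functions and primitives of [(l - f) m] *)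

Definition unimodal (f : R -> R) (xhat : R) : Prop :=
  (forall x y, x < y <= xhat -> f y < f x) /\
  (forall x y, xhat <= x < y -> f x < f y).

(** Strictness extends to the minimiser by passing through the midpoint [z] of [x] and [xhat]:
    [f xhat <= f z < f x]. *)
Lemma argmin_unimodal (f : R -> R) (xhat : R) :
  is_unique_argmin f xhat -> decreasing_then_increasing f xhat ->
  unimodal f xhat.
Proof.
intros [Hmin _] [Hd Hi]; split; intros x y Hxy.
- destruct (Req_dec y xhat) as [->|E]; [|apply Hd; lra].
  pose proof (Hmin ((x + xhat) / 2)).
  assert (f ((x + xhat) / 2) < f x) by (apply Hd; lra); lra.
- destruct (Req_dec x xhat) as [->|E]; [|apply Hi; lra].
  pose proof (Hmin ((y + xhat) / 2)).
  assert (f ((y + xhat) / 2) < f y) by (apply Hi; lra); lra.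
Qed.

Section Unimodal.

Context (f : R -> R) (xhat : R) (f_unimodal : unimodal f xhat).

Lemma unimodal_min (x : R) : f xhat <= f x.
Proof.
destruct f_unimodal as [Hd Hi].
destruct (Rtotal_order x xhat) as [H|[->|H]]; [|lra|].
- specialize (Hd x xhat); lra.
- specialize (Hi xhat x); lra.
Qed.

Lemma unimodal_quasiconvex (x y z l : R) :
  x <= y <= z -> f x <= l -> f z <= l -> f y <= l.
Proof.
destruct f_unimodal as [Hd Hi]; intros [[Hxy| ->] [Hyz| <-]] Hx Hz; try lra.
destruct (Rle_or_lt y xhat).
- specialize (Hd x y); lra.
- specialize (Hi y z); lra.
Qed.

Lemma unimodal_level_right (l : R) :
  (forall x, continuous f x) -> is_lim f p_infty p_infty -> f xhat <= l ->
  exists x, xhat <= x /\ f x = l.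
Proof.
intros Hc Hlim Hl.
destruct (proj2 (is_lim_spec f p_infty p_infty) Hlim l) as [N HN].
set (y := Rmax xhat N + 1).
assert (Hy : xhat < y /\ N < y)
  by (unfold y; pose proof (Rmax_l xhat N); pose proof (Rmax_r xhat N); lra).
pose proof (HN y (proj2 Hy)) as Hfy.
destruct (IVT_gen f xhat y l) as [x [Hx E]].
- intros x; now apply continuous_continuity_pt.
- rewrite Rmin_left, Rmax_right; lra.
- rewrite Rmin_left, Rmax_right in Hx by lra; exists x; lra.
Qed.

Lemma unimodal_level_left (l : R) :
  (forall x, continuous f x) -> is_lim f m_infty p_infty -> f xhat <= l ->
  exists x, x <= xhat /\ f x = l.
Proof.
intros Hc Hlim Hl.
destruct (proj2 (is_lim_spec f m_infty p_infty) Hlim l) as [N HN].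
set (y := Rmin xhat N - 1).
assert (Hy : y < xhat /\ y < N)
  by (unfold y; pose proof (Rmin_l xhat N); pose proof (Rmin_r xhat N); lra).
pose proof (HN y (proj2 Hy)) as Hfy.
destruct (IVT_gen f xhat y l) as [x [Hx E]].
- intros x; now apply continuous_continuity_pt.
- rewrite Rmin_left, Rmax_right; lra.
- rewrite Rmin_right, Rmax_left in Hx by lra; exists x; lra.
Qed.

Context (m Phi : R -> R) (l : R) (m_gt0 : forall x, 0 < m x).
Context (Phi_derive : forall x, is_derive Phi x ((l - f x) * m x)).

Lemma derive_sign_below (x y : R) :
  x <= y -> (forall t, x <= t <= y -> f t <= l) -> Phi x <= Phi y.
Proof.
intros Hxy H; apply (derive_ge0_nondecreasing _ _ _ _ Phi_derive Hxy).
intros t Ht; specialize (H t Ht); pose proof (m_gt0 t); nra.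
Qed.

Lemma derive_sign_above (x y : R) :
  x <= y -> (forall t, x <= t <= y -> l <= f t) -> Phi y <= Phi x.
Proof.
intros Hxy H; apply (derive_le0_nonincreasing _ _ _ _ Phi_derive Hxy).
intros t Ht; specialize (H t Ht); pose proof (m_gt0 t); nra.
Qed.

(** On the increasing branch [f] is at most [l] before [p] and at least [l] after it, so [Phi] rises
    up to [p] and falls afterwards. *)
Lemma level_right_maximises (p x : R) :
  f p = l -> xhat <= p -> xhat <= x -> Phi x <= Phi p.
Proof.
destruct f_unimodal as [_ Hi]; intros E Hp Hx.
destruct (Rle_or_lt x p).
- apply derive_sign_below; [lra|]; intros t Ht.
  destruct (Req_dec t p) as [->|]; [lra|]; specialize (Hi t p); lra.
- apply derive_sign_above; [lra|]; intros t Ht.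
  destruct (Req_dec t p) as [->|]; [lra|]; specialize (Hi p t); lra.
Qed.

Lemma level_left_minimises (p x : R) :
  f p = l -> p <= xhat -> x <= xhat -> Phi p <= Phi x.
Proof.
destruct f_unimodal as [Hd _]; intros E Hp Hx.
destruct (Rle_or_lt p x).
- apply derive_sign_below; [lra|]; intros t Ht.
  destruct (Req_dec t p) as [->|]; [lra|]; specialize (Hd p t); lra.
- apply derive_sign_above; [lra|]; intros t Ht.
  destruct (Req_dec t p) as [->|]; [lra|]; specialize (Hd t p); lra.
Qed.

(** If [f x <= l], quasiconvexity gives [f <= l] on all of [[p, x]] and [Phi] rises there. Otherwise
    [x] lies on the increasing branch, so [f > l] up to [q], and [Phi] falls from [x] to [Phi q],
    which is at least [Phi p]. *)
Lemma level_left_minimises_between (p x q : R) :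
  f p = l -> p <= xhat -> p <= x <= q -> Phi p <= Phi q -> Phi p <= Phi x.
Proof.
destruct f_unimodal as [Hd Hi]; intros E Hp Hx Hpq.
destruct (Rle_or_lt (f x) l) as [Hf|Hf].
- apply derive_sign_below; [lra|]; intros t Ht.
  apply (unimodal_quasiconvex p t x); lra.
- assert (xhat < x).
  { apply Rnot_le_lt; intros Hxx.
    destruct (Req_dec x p) as [->|]; [lra|]; specialize (Hd p x); lra. }
  apply Rle_trans with (1 := Hpq), derive_sign_above; [lra|]; intros t Ht.
  destruct (Req_dec t x) as [->|]; [lra|]; specialize (Hi x t); lra.
Qed.

Lemma level_right_maximises_between (p x q : R) :
  f q = l -> xhat <= q -> p <= x <= q -> Phi p <= Phi q -> Phi x <= Phi q.
Proof.
destruct f_unimodal as [Hd Hi]; intros E Hq Hx Hpq.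
destruct (Rle_or_lt (f x) l) as [Hf|Hf].
- apply derive_sign_below; [lra|]; intros t Ht.
  apply (unimodal_quasiconvex x t q); lra.
- assert (x < xhat).
  { apply Rnot_le_lt; intros Hxx.
    destruct (Req_dec x q) as [->|]; [lra|]; specialize (Hi x q); lra. }
  apply Rle_trans with (2 := Hpq), derive_sign_above; [lra|]; intros t Ht.
  destruct (Req_dec t x) as [->|]; [lra|]; specialize (Hd t x); lra.
Qed.

End Unimodal.

(** * Stationary pairs of boundaries and their gain *)

Section OptimalBoundaries.

Context (mu sigma c g m M C : R -> R) (qu qd xhat1 xhat2 : R).
Context (mu_continuous : forall x, continuous mu x).
Context (c_continuous : forall x, continuous c x).
Context (m_continuous : forall x, continuous m x).
Context (sigma2_gt0 : forall x, 0 < sigma x ^ 2).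
Context (g_gt0 : forall x, 0 < g x) (m_def : forall x, m x = 2 / sigma x ^ 2 * g x).
Context (g_derive : forall x, is_derive g x (mu x * m x)).
Context (M_derive : forall x, is_derive M x (m x)).
Context (C_derive : forall x, is_derive C x (c x * m x)).
Context (c_ge0 : forall x, 0 <= c x).
Context (qu_ge0 : 0 <= qu) (qd_ge0 : 0 <= qd) (q_gt0 : 0 < qu + qd).

Let f1 : R -> R := pi1 mu c qd.
Let f2 : R -> R := pi2 mu c qu.

Context (f1_unimodal : unimodal f1 xhat1) (f2_unimodal : unimodal f2 xhat2).
Context (f1_lim : is_lim f1 p_infty p_infty) (f2_lim : is_lim f2 m_infty p_infty).

Definition Phi (q l x : R) : R := l * M x - C x - q * g x.

Lemma m_gt0 (x : R) : 0 < m x.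
Proof.
rewrite m_def; apply Rmult_lt_0_compat; [apply Rdiv_lt_0_compat|]; auto; lra.
Qed.

Lemma M_increasing (x y : R) : x < y -> M x < M y.
Proof. apply (derive_gt0_increasing M m x y M_derive m_gt0). Qed.

Lemma M_nondecreasing (x y : R) : x <= y -> M x <= M y.
Proof. intros [H| ->]; [left; now apply M_increasing|lra]. Qed.

Lemma Phi_derive (q l x : R) :
  is_derive (Phi q l) x ((l - (c x + q * mu x)) * m x).
Proof.
replace ((l - (c x + q * mu x)) * m x)
  with (l * m x - c x * m x - q * (mu x * m x)) by ring.
apply (is_derive_minus (fun x => l * M x - C x) (fun x => q * g x) x).
- apply (is_derive_minus (fun x => l * M x) C x); [|apply C_derive].
  apply (is_derive_scal M x l (m x) (M_derive x)).
- apply (is_derive_scal g x q _ (g_derive x)).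
Qed.

Lemma Phi_qd_derive (l x : R) : is_derive (Phi qd l) x ((l - f1 x) * m x).
Proof. exact (Phi_derive qd l x). Qed.

Lemma Phi_qu_derive (l x : R) : is_derive (Phi (- qu) l) x ((l - f2 x) * m x).
Proof.
replace ((l - f2 x) * m x) with ((l - (c x + - qu * mu x)) * m x)
  by (unfold f2, pi2; ring).
apply Phi_derive.
Qed.

Lemma f1_continuous (x : R) : continuous f1 x.
Proof.
apply (continuous_plus c (fun x => qd * mu x) x); [apply c_continuous|].
apply (continuous_scal_r qd mu x (mu_continuous x)).
Qed.

Lemma f2_continuous (x : R) : continuous f2 x.
Proof.
apply (continuous_minus c (fun x => qu * mu x) x); [apply c_continuous|].
apply (continuous_scal_r qu mu x (mu_continuous x)).
Qed.

(** For [a < b] this is the speed measure of the interval times the difference between [l] and the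
    average cost of reflecting at [a] and [b], so it vanishes exactly when [l] is that cost. *)
Definition gain (l a b : R) : R := Phi qd l b - Phi (- qu) l a.

(* The first two clauses select the branches of the level sets of pi_2 and pi_1
   on which the level determines the point. *)
Definition stationary (l a b : R) : Prop :=
  a <= xhat2 /\ xhat1 <= b /\ f2 a = l /\ f1 b = l.

(** A subgradient inequality: with the pair fixed, changing the level adds the affine term; then the
    pair that is stationary for [l'] maximises the gain at level [l']. Continuity in the level and
    uniqueness of the zero both follow from it. *)
Lemma gain_le (l a b l' a' b' : R) :
  stationary l a b -> stationary l' a' b' ->
  gain l a b + (l' - l) * (M b - M a) <= gain l' a' b'.
Proof.
intros (Ha & Hb & _) (Ha' & Hb' & E2 & E1).
apply Rle_trans with (gain l' a b); [unfold gain, Phi; lra|].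
apply Rplus_le_compat; [|apply Ropp_le_contravar].
- exact (level_right_maximises _ _ f1_unimodal _ _ _ m_gt0
           (Phi_qd_derive l') _ _ E1 Hb' Hb).
- exact (level_left_minimises _ _ f2_unimodal _ _ _ m_gt0
           (Phi_qu_derive l') _ _ E2 Ha' Ha).
Qed.

Lemma stationary_nested (l a b l' a' b' : R) :
  stationary l a b -> stationary l' a' b' -> l < l' -> a' < a /\ b < b'.
Proof.
intros (Ha & Hb & E2 & E1) (Ha' & Hb' & E2' & E1') Hl.
destruct f1_unimodal as [_ H1], f2_unimodal as [H2 _].
split; apply Rnot_le_lt; intros [H|H]; subst; try lra.
- specialize (H2 a a'); lra.
- specialize (H1 b' b); lra.
Qed.

Lemma stationary_unique (l a b a' b' : R) :
  stationary l a b -> stationary l a' b' -> a = a' /\ b = b'.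
Proof.
intros (Ha & Hb & E2 & E1) (Ha' & Hb' & E2' & E1').
destruct f1_unimodal as [_ H1], f2_unimodal as [H2 _].
split.
- destruct (Rtotal_order a a') as [H|[H|H]]; trivial; exfalso;
    [specialize (H2 a a')|specialize (H2 a' a)]; lra.
- destruct (Rtotal_order b b') as [H|[H|H]]; trivial; exfalso;
    [specialize (H1 b b')|specialize (H1 b' b)]; lra.
Qed.

Lemma stationary_nested_weak (l a b l' a' b' : R) :
  stationary l a b -> stationary l' a' b' -> l <= l' -> a' <= a /\ b <= b'.
Proof.
intros Hs Hs' [Hl| <-].
- destruct (stationary_nested _ _ _ _ _ _ Hs Hs' Hl); lra.
- destruct (stationary_unique _ _ _ _ _ Hs Hs'); lra.
Qed.

Lemma stationary_exists (l : R) :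
  f1 xhat1 <= l -> f2 xhat2 <= l -> exists a b, stationary l a b.
Proof.
intros H1 H2.
destruct (unimodal_level_left f2 xhat2 l f2_continuous f2_lim H2) as [a Ha].
destruct (unimodal_level_right f1 xhat1 l f1_continuous f1_lim H1) as [b Hb].
now exists a, b; unfold stationary.
Qed.

(** Using a single [Phi] at both ends isolates a strictly negative cost term and leaves an increment
    whose sign is governed by one of the two unimodal functions. *)
Lemma gain_eq_qu (l a b : R) :
  gain l a b = Phi (- qu) l b - Phi (- qu) l a - (qu + qd) * g b.
Proof. unfold gain, Phi; ring. Qed.

Lemma gain_eq_qd (l a b : R) :
  gain l a b = Phi qd l b - Phi qd l a - (qu + qd) * g a.
Proof. unfold gain, Phi; ring. Qed.

Lemma cost_gt0 (x : R) : 0 < (qu + qd) * g x.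
Proof. now apply Rmult_lt_0_compat. Qed.

(* If the two levels at the larger of the minima are in the wrong order, the
   curves pi_1 and pi_2 cross between them; start from the crossing. *)
Lemma stationary_start :
  exists l a b, stationary l a b /\ a <= b /\ gain l a b < 0.
Proof.
destruct (stationary_exists (Rmax (f1 xhat1) (f2 xhat2))
  (Rmax_l _ _) (Rmax_r _ _)) as (a & b & Hs).
destruct (Rle_or_lt a b) as [Hab|Hab].
- exists (Rmax (f1 xhat1) (f2 xhat2)), a, b; split; [exact Hs|split; [exact Hab|]].
  (* The level is the minimum of one of the two functions, so the matching [Phi] is nonincreasing
     and the gain is at most minus the cost term. *)
  unfold Rmax; destruct Rle_dec as [H|H].
  + rewrite gain_eq_qu; pose proof (cost_gt0 b).
    enough (Phi (- qu) (f2 xhat2) b <= Phi (- qu) (f2 xhat2) a) by lra.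
    apply (derive_sign_above f2 m _ _ m_gt0 (Phi_qu_derive _) _ _ Hab).
    intros t _; now apply unimodal_min.
  + rewrite gain_eq_qd; pose proof (cost_gt0 a).
    enough (Phi qd (f1 xhat1) b <= Phi qd (f1 xhat1) a) by lra.
    apply (derive_sign_above f1 m _ _ m_gt0 (Phi_qd_derive _) _ _ Hab).
    intros t _; now apply unimodal_min.
- destruct Hs as (Ha & Hb & E2 & E1).
  assert (H1 : f1 b < f1 a) by (apply (proj2 f1_unimodal); lra).
  assert (H2 : f2 a < f2 b) by (apply (proj1 f2_unimodal); lra).
  destruct (IVT_gen (fun x => f1 x - f2 x) b a 0) as [x [Hx E]].
  + intros x; apply continuous_continuity_pt, (continuous_minus f1 f2 x).
    * apply f1_continuous.
    * apply f2_continuous.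
  + rewrite Rmin_left, Rmax_right; lra.
  + rewrite Rmin_left, Rmax_right in Hx by lra.
    (* The crossing lies between [xhat1] and [xhat2], hence on both branches, and the degenerate
       pair [(x, x)] has gain minus the cost term. *)
    exists (f1 x), x, x; unfold stationary; repeat split; try lra.
    rewrite gain_eq_qd; pose proof (cost_gt0 x); lra.
Qed.

Lemma stationary_gain_zero_exists :
  exists l a b, stationary l a b /\ a < xhat2 /\ xhat1 < b /\ a < b /\
    gain l a b = 0.
Proof.
destruct stationary_start as (l0 & a0 & b0 & Hs0 & Hab0 & Hg0).
assert (Hex : forall l, l0 <= l -> exists a b, stationary l a b).
{ intros l Hl; destruct Hs0 as (_ & _ & E2 & E1).
  pose proof (unimodal_min f1 xhat1 f1_unimodal b0).
  pose proof (unimodal_min f2 xhat2 f2_unimodal a0).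
  apply stationary_exists; lra. }
(* Possibly [a0 = b0]; raising the level by 1 gives a nondegenerate pair, hence a positive slope
   [d]. *)
destruct (Hex (l0 + 1)) as (a1 & b1 & Hs1); [lra|].
destruct (stationary_nested _ _ _ _ _ _ Hs0 Hs1) as [Ha1 Hb1]; [lra|].
set (d := M b1 - M a1).
assert (Hd : 0 < d) by (unfold d; pose proof (M_increasing a1 b1); lra).
(* Chosen so that the affine lower bound of [gain_le] from level [l0 + 1] is at least 1 at [l2]. *)
set (l2 := l0 + 1 + (Rabs (gain (l0 + 1) a1 b1) + 1) / d).
assert (Hl2d : (l2 - (l0 + 1)) * d = Rabs (gain (l0 + 1) a1 b1) + 1)
  by (unfold l2; field; lra).
assert (Hl2 : l0 < l2).
{ enough (0 < l2 - (l0 + 1)) by lra.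
  apply Rmult_lt_reg_r with (1 := Hd).
  pose proof (Rabs_pos (gain (l0 + 1) a1 b1)); lra. }
destruct (Hex l2) as (a2 & b2 & Hs2); [lra|].
assert (Hg2 : 0 < gain l2 a2 b2).
{ pose proof (gain_le _ _ _ _ _ _ Hs1 Hs2); fold d in H.
  pose proof (Rle_abs (- gain (l0 + 1) a1 b1)); rewrite Rabs_Ropp in *; lra. }
(* Clamping the level makes a stationary pair available for every real [l], so that choice yields a
   total function and [F] is continuous on the whole line, as [IVT_gen] requires. *)
destruct (functional_choice
  (fun l p => stationary (clamp l0 l2 l) (fst p) (snd p))) as [p Hp].
{ intros l; destruct (Hex (clamp l0 l2 l)) as (a & b & Hs).
  - apply clamp_bounds; lra.
  - now exists (a, b). }
set (F := fun l => gain (clamp l0 l2 l) (fst (p l)) (snd (p l))).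
assert (HM : forall l, 0 <= M (snd (p l)) - M (fst (p l)) <= M b2 - M a2).
{ intros l; destruct (clamp_bounds l0 l2 l) as [Hl Hr]; [lra|].
  destruct (stationary_nested_weak _ _ _ _ _ _ Hs0 (Hp l) Hl).
  destruct (stationary_nested_weak _ _ _ _ _ _ (Hp l) Hs2 Hr).
  pose proof (M_nondecreasing (fst (p l)) (snd (p l))).
  pose proof (M_nondecreasing a2 (fst (p l))).
  pose proof (M_nondecreasing (snd (p l)) b2); lra. }
destruct (IVT_gen F l0 l2 0) as [l [Hl E]].
- intros x; apply continuous_continuity_pt.
  apply nondecreasing_lipschitz_continuous with (M b2 - M a2).
  intros y z Hyz; unfold F.
  pose proof (clamp_lipschitz l0 l2 y z Hyz).
  pose proof (gain_le _ _ _ _ _ _ (Hp y) (Hp z)).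
  pose proof (gain_le _ _ _ _ _ _ (Hp z) (Hp y)).
  pose proof (HM y); pose proof (HM z).
  set (cy := clamp l0 l2 y) in *; set (cz := clamp l0 l2 z) in *.
  (* [gain_le] in both directions encloses the increment of [F] between the slopes at [y] and [z]
     times [cz - cy]; the bounds [HM] on the slopes make [F] nondecreasing and Lipschitz. *)
  assert (0 <= (cz - cy) * (M (snd (p y)) - M (fst (p y)))) by (apply Rmult_le_pos; lra).
  assert ((cz - cy) * (M (snd (p z)) - M (fst (p z))) <= (z - y) * (M b2 - M a2))
    by (apply Rmult_le_compat; lra).
  lra.
(* The chosen pair at [l0] is not known to be [(a0, b0)]; [gain_le] between equal levels compares
   the two, and likewise at [l2]. *)
- assert (F l0 <= gain l0 a0 b0).
  { pose proof (gain_le _ _ _ _ _ _ (Hp l0) Hs0) as H; unfold F.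
    rewrite clamp_left in * by lra; lra. }
  assert (gain l2 a2 b2 <= F l2).
  { pose proof (gain_le _ _ _ _ _ _ Hs2 (Hp l2)) as H1; unfold F.
    rewrite clamp_right in * by lra; lra. }
  rewrite Rmin_left, Rmax_right; lra.
- rewrite Rmin_left, Rmax_right in Hl by lra.
  pose proof (Hp l) as Hs; unfold F in E; rewrite clamp_id in Hs, E by lra.
  exists l, (fst (p l)), (snd (p l)).
  (* At level [l0] the gain is negative, so the zero sits strictly above it; strict nesting then
     yields all the strict inequalities. *)
  assert (Hl' : l0 < l).
  { apply Rnot_le_lt; intros Hle; assert (E0 : l0 - l = 0) by lra.
    pose proof (gain_le _ _ _ _ _ _ Hs Hs0) as H; rewrite E0 in H; lra. }
  destruct (stationary_nested _ _ _ _ _ _ Hs0 Hs Hl').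
  destruct Hs0 as (? & ? & _); repeat split; try apply Hs; lra.
Qed.

(** With both gains zero, [gain_le] in the two directions bounds [l' - l] times a positive slope
    from above and from below by zero. *)
Lemma stationary_gain_zero_unique (l a b l' a' b' : R) :
  stationary l a b -> stationary l' a' b' -> a < b -> a' < b' ->
  gain l a b = 0 -> gain l' a' b' = 0 -> a = a' /\ b = b'.
Proof.
intros Hs Hs' Hab Hab' E E'.
pose proof (gain_le _ _ _ _ _ _ Hs Hs').
pose proof (gain_le _ _ _ _ _ _ Hs' Hs).
pose proof (M_increasing _ _ Hab); pose proof (M_increasing _ _ Hab').
assert (l = l') as -> by nra.
exact (stationary_unique _ _ _ _ _ Hs Hs').
Qed.

(** * The free boundary problem at a stationary pair of zero gain *)

Section FreeBoundary.

Context (l a b : R) (ab : a < b).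
Context (ab_stationary : stationary l a b) (ab_gain : gain l a b = 0).

Lemma Phi_qu_ends : Phi (- qu) l b - Phi (- qu) l a = (qu + qd) * g b.
Proof. rewrite gain_eq_qu in ab_gain; lra. Qed.

Lemma Phi_qd_ends : Phi qd l b - Phi qd l a = (qu + qd) * g a.
Proof. rewrite gain_eq_qd in ab_gain; lra. Qed.

(** Here [u] stands for [v'(x)]. Leaving it abstract lets the bound serve both for an arbitrary
    solution and for the nonnegativity of the one constructed below. *)
Lemma marginal_bounds (u x : R) :
  a <= x <= b -> (u + qu) * g x = Phi (- qu) l x - Phi (- qu) l a -> - qu <= u <= qd.
Proof.
intros Hx E; destruct ab_stationary as (Ha & Hb & E2 & E1).
pose proof (cost_gt0 a); pose proof (cost_gt0 b).
pose proof Phi_qu_ends; pose proof Phi_qd_ends; pose proof (g_gt0 x).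
split.
- pose proof (level_left_minimises_between _ _ f2_unimodal _ _ _ m_gt0
    (Phi_qu_derive l) _ _ _ E2 Ha Hx); nra.
- pose proof (level_right_maximises_between _ _ f1_unimodal _ _ _ m_gt0
    (Phi_qd_derive l) _ _ _ E1 Hb Hx).
  (* Zero gain trades the base point [a] and cost [- qu] for the base point [b] and cost [qd]. *)
  assert ((u - qd) * g x = Phi qd l x - Phi qd l b)
    by (unfold gain, Phi in *; lra).
  nra.
Qed.

Lemma solution_marginal (v : R -> R) (lambda : R) :
  solves_free_boundary_problem mu sigma c qu qd a b v lambda ->
  (forall x, x <= a -> Derive v x = - qu) /\
  (forall x, b <= x -> Derive v x = qd) /\
  (forall x, a <= x <= b ->
     (Derive v x + qu) * g x = Phi (- qu) lambda x - Phi (- qu) lambda a).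
Proof.
intros (Hv & _ & _ & Hgen & Hr & Hl).
assert (Cu : forall x, continuous (Derive v) x)
  by (intros x; apply (ex_derive_continuous (Derive v)), Hv).
assert (Hl' : forall x, x < a -> Derive v x = - qu).
{ intros x Hx; apply is_derive_unique.
  apply (is_derive_ext_loc (fun y => qu * (a - y) + v a)); [|auto_derive; [trivial|ring]].
  exists (mkposreal (a - x) ltac:(lra)); intros y Hy; symmetry; apply Hl.
  apply Rabs_lt_between in Hy; unfold minus, plus, opp in Hy; simpl in Hy; lra. }
assert (Hr' : forall x, b < x -> Derive v x = qd).
{ intros x Hx; apply is_derive_unique.
  apply (is_derive_ext_loc (fun y => qd * (y - b) + v b)); [|auto_derive; [trivial|ring]].
  exists (mkposreal (x - b) ltac:(lra)); intros y Hy; symmetry; apply Hr.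
  apply Rabs_lt_between in Hy; unfold minus, plus, opp in Hy; simpl in Hy; lra. }
assert (Ea : Derive v a = - qu).
{ apply continuous_adherent_value; [apply Cu|]; intros d Hd.
  exists (a - d / 2); rewrite Rabs_left by lra; split; [lra|apply Hl'; lra]. }
assert (Eb : Derive v b = qd).
{ apply continuous_adherent_value; [apply Cu|]; intros d Hd.
  exists (b + d / 2); rewrite Rabs_pos_eq by lra; split; [lra|apply Hr'; lra]. }
split; [|split].
- intros x [Hx| ->]; auto.
- intros x [Hx| <-]; auto.
- intros x Hx.
  (* Multiplying the equation by [m] turns its left side into the derivative of [v' g] plus [c m],
     so [v' g] has the same derivative as [Phi] with [q = 0]. *)
  assert (Derive v x * g x - Derive v a * g a
          = Phi 0 lambda x - Phi 0 lambda a) as E.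
  { apply (eq_derive_eq_increment (fun y => Derive v y * g y) (Phi 0 lambda)
             (fun y => (lambda - (c y + 0 * mu y)) * m y)); [lra| | | |].
    - intros y Hy.
      replace ((lambda - (c y + 0 * mu y)) * m y)
        with (Derive (Derive v) y * g y + Derive v y * (mu y * m y)).
      + apply (is_derive_mult (Derive v) g y); [apply Derive_correct, Hv|apply g_derive|].
        intros; apply Rmult_comm.
      + rewrite <- (Hgen y) by lra; unfold generator; rewrite m_def.
        field; intros Hs; pose proof (sigma2_gt0 y); rewrite Hs in *; lra.
    - intros y _; apply Phi_derive.
    - intros y _; apply (continuous_mult (Derive v) g y); [apply Cu|].
      exact (is_derive_continuous _ _ _ (g_derive y)).
    - intros y _; exact (is_derive_continuous _ _ _ (Phi_derive _ _ y)). }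
  rewrite Ea in E; unfold Phi in *; lra.
Qed.

(** The identity for [v'] at [x = b] says that the gain at level [lambda] is zero too, and the gain
    is affine in the level with slope [M b - M a > 0]. *)
Lemma solution_lambda (v : R -> R) (lambda : R) :
  solves_free_boundary_problem mu sigma c qu qd a b v lambda -> lambda = l.
Proof.
intros Hv; destruct (solution_marginal v lambda Hv) as (_ & Hr & Hm).
specialize (Hm b); rewrite Hr in Hm by lra.
pose proof (M_increasing a b ab).
unfold gain, Phi in *.
apply Rmult_eq_reg_r with (M b - M a); lra.
Qed.

Lemma solution_marginal_bounds (v : R -> R) (lambda : R) (x : R) :
  solves_free_boundary_problem mu sigma c qu qd a b v lambda ->
  - qu <= Derive v x <= qd.
Proof.
intros Hv; pose proof (solution_lambda v lambda Hv) as ->.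
destruct (solution_marginal v l Hv) as (Hl & Hr & Hm).
destruct (Rle_or_lt x a) as [Hx|Hx]; [rewrite Hl; lra|].
destruct (Rle_or_lt b x) as [Hx'|Hx']; [rewrite Hr; lra|].
apply (marginal_bounds (Derive v x) x); [lra|apply Hm; lra].
Qed.

(** * Construction of a solution *)

Lemma level_ge0 : 0 <= l.
Proof.
pose proof (M_increasing a b ab); pose proof (g_gt0 a); pose proof (g_gt0 b).
assert (C a <= C b).
{ apply (derive_ge0_nondecreasing C _ a b C_derive); [lra|]; intros x _.
  apply Rmult_le_pos; [apply c_ge0|left; apply m_gt0]. }
unfold gain, Phi in ab_gain; nra.
Qed.

(** The identity of [solution_marginal] at [lambda = l], solved for [v']. *)
Definition marginal (x : R) : R :=
  (Phi (- qu) l x - Phi (- qu) l a) / g x - qu.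

Definition marginal_derive (x : R) : R :=
  ((l - f2 x) - (Phi (- qu) l x - Phi (- qu) l a) / g x * mu x) * (m x / g x).

Lemma g_neq0 (x : R) : g x <> 0.
Proof. apply Rgt_not_eq, g_gt0. Qed.

Lemma is_derive_marginal (x : R) : is_derive marginal x (marginal_derive x).
Proof.
replace (marginal_derive x) with
  (((l - f2 x) * m x * g x - (Phi (- qu) l x - Phi (- qu) l a) * (mu x * m x))
     / g x ^ 2)
  by (unfold marginal_derive; field; apply g_neq0).
apply is_derive_ext with (fun y => plus ((Phi (- qu) l y - Phi (- qu) l a) / g y) (- qu)).
{ intros y; reflexivity. }
rewrite <- (plus_zero_r (_ / g x ^ 2)).
apply (is_derive_plus (fun y => (Phi (- qu) l y - Phi (- qu) l a) / g y)
         (fun _ => - qu)); [|exact (is_derive_const (V := R_NormedModule) (- qu) x)].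
apply (is_derive_div (fun y => Phi (- qu) l y - Phi (- qu) l a) g x);
  [|apply g_derive|apply g_neq0].
rewrite <- (Rminus_0_r ((l - f2 x) * m x)).
apply (is_derive_minus (Phi (- qu) l) (fun _ => Phi (- qu) l a) x).
- apply Phi_qu_derive.
- exact (is_derive_const (V := R_NormedModule) _ x).
Qed.

Lemma continuous_marginal_derive (x : R) : continuous marginal_derive x.
Proof.
assert (Cg : forall k, continuous k x -> continuous (fun y => k y / g y) x).
{ intros k Hk; apply (continuous_mult k (fun y => / g y) x Hk).
  apply continuous_Rinv_comp; [|apply g_neq0].
  exact (is_derive_continuous _ _ _ (g_derive x)). }
apply (continuous_mult _ (fun y => m y / g y) x); [|apply Cg, m_continuous].
apply (continuous_minus (fun y => l - f2 y)
         (fun y => (Phi (- qu) l y - Phi (- qu) l a) / g y * mu y) x).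
- apply (continuous_minus (fun _ => l) f2 x); [apply continuous_const|apply f2_continuous].
- apply (continuous_mult _ mu x); [|apply mu_continuous]; apply Cg.
  apply (continuous_minus (Phi (- qu) l) (fun _ => Phi (- qu) l a) x);
    [|apply continuous_const].
  exact (is_derive_continuous _ _ _ (Phi_qu_derive l x)).
Qed.

Lemma marginal_a : marginal a = - qu.
Proof. unfold marginal; field; apply g_neq0. Qed.

Lemma marginal_b : marginal b = qd.
Proof. unfold marginal; rewrite Phi_qu_ends; field; apply g_neq0. Qed.

Lemma marginal_derive_a : marginal_derive a = 0.
Proof.
destruct ab_stationary as (_ & _ & E2 & _).
unfold marginal_derive; rewrite E2; field; apply g_neq0.
Qed.

(** At [b] the quotient in [marginal_derive] equals [qu + qd], and [f2 + (qu + qd) mu = f1], so what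
    remains is [l - f1 b = 0]. *)
Lemma marginal_derive_b : marginal_derive b = 0.
Proof.
destruct ab_stationary as (_ & _ & _ & E1).
unfold marginal_derive; rewrite Phi_qu_ends, <- E1.
unfold f1, f2, pi1, pi2; field; apply g_neq0.
Qed.

Lemma marginal_ode (x : R) :
  / 2 * sigma x ^ 2 * marginal_derive x + mu x * marginal x + c x = l.
Proof.
unfold marginal_derive, marginal; rewrite m_def; unfold f2, pi2.
field; split; [apply g_neq0|].
intros Hs; pose proof (sigma2_gt0 x); rewrite Hs in *; lra.
Qed.

(* Extending [marginal] by its constant end values amounts to freezing its
   derivative, which vanishes at both ends. *)
Definition marginal2_ext (x : R) : R := marginal_derive (clamp a b x).
Definition marginal_ext (x : R) : R := - qu + RInt marginal2_ext a x.
(** The additive constant is free in the equations; starting from [qu * (b - a)] at [a], a slope of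
    at least [- qu] keeps the function nonnegative up to [b]. *)
Definition value (x : R) : R := qu * (b - a) + RInt marginal_ext a x.

Lemma continuous_marginal2_ext (x : R) : continuous marginal2_ext x.
Proof.
apply (continuous_comp (clamp a b) marginal_derive x).
- apply nondecreasing_lipschitz_continuous with 1; apply clamp_lipschitz.
- apply continuous_marginal_derive.
Qed.

Lemma is_derive_marginal_ext (x : R) : is_derive marginal_ext x (marginal2_ext x).
Proof.
rewrite <- (plus_zero_l (marginal2_ext x)).
apply (is_derive_plus (fun _ => - qu) (fun y => RInt marginal2_ext a y)).
- exact (is_derive_const (V := R_NormedModule) (- qu) x).
- apply is_derive_RInt_continuous, continuous_marginal2_ext.
Qed.

Lemma continuous_marginal_ext (x : R) : continuous marginal_ext x.
Proof. exact (is_derive_continuous _ _ _ (is_derive_marginal_ext x)). Qed.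

Lemma is_derive_value (x : R) : is_derive value x (marginal_ext x).
Proof.
rewrite <- (plus_zero_l (marginal_ext x)).
apply (is_derive_plus (fun _ => qu * (b - a)) (fun y => RInt marginal_ext a y)).
- exact (is_derive_const (V := R_NormedModule) _ x).
- apply is_derive_RInt_continuous, continuous_marginal_ext.
Qed.

Lemma marginal_ext_a : marginal_ext a = - qu.
Proof. unfold marginal_ext; rewrite RInt_point; unfold zero; simpl; ring. Qed.

Lemma marginal_ext_mid (x : R) : a <= x <= b -> marginal_ext x = marginal x.
Proof.
intros Hx; enough (marginal_ext x - marginal_ext a = marginal x - marginal a)
  by (rewrite marginal_ext_a, marginal_a in *; lra).
apply (eq_derive_eq_increment _ _ marginal2_ext); [lra| | | |].
- intros y _; apply is_derive_marginal_ext.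
- intros y Hy; unfold marginal2_ext; rewrite clamp_id by lra.
  apply is_derive_marginal.
- intros y _; apply continuous_marginal_ext.
- intros y _; exact (is_derive_continuous _ _ _ (is_derive_marginal y)).
Qed.

Lemma is_derive_zero (k x d : R) : d = 0 -> is_derive (fun _ : R => k) x d.
Proof. intros ->; exact (is_derive_const (V := R_NormedModule) k x). Qed.

Lemma marginal_ext_left (x : R) : x <= a -> marginal_ext x = - qu.
Proof.
intros Hx; enough (marginal_ext a - marginal_ext x = 0 - 0)
  by (rewrite marginal_ext_a in *; lra).
apply (eq_derive_eq_increment _ (fun _ => 0) marginal2_ext x a Hx).
- intros y _; apply is_derive_marginal_ext.
- intros y Hy; apply is_derive_zero; unfold marginal2_ext.
  rewrite clamp_left by lra; apply marginal_derive_a.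
- intros y _; apply continuous_marginal_ext.
- intros y _; apply continuous_const.
Qed.

Lemma marginal_ext_right (x : R) : b <= x -> marginal_ext x = qd.
Proof.
intros Hx; enough (marginal_ext x - marginal_ext b = 0 - 0)
  by (rewrite (marginal_ext_mid b), marginal_b in *; lra).
apply (eq_derive_eq_increment _ (fun _ => 0) marginal2_ext b x Hx).
- intros y _; apply is_derive_marginal_ext.
- intros y Hy; apply is_derive_zero; unfold marginal2_ext.
  rewrite clamp_right by lra; apply marginal_derive_b.
- intros y _; apply continuous_marginal_ext.
- intros y _; apply continuous_const.
Qed.

Lemma value_a : value a = qu * (b - a).
Proof. unfold value; rewrite RInt_point; unfold zero; simpl; ring. Qed.

Lemma value_affine (k x y : R) :
  x <= y -> (forall t, x < t < y -> marginal_ext t = k) ->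
  value y - value x = k * y - k * x.
Proof.
intros Hxy H; apply (eq_derive_eq_increment value (fun t => k * t) marginal_ext _ _ Hxy).
- intros t _; apply is_derive_value.
- intros t Ht; rewrite (H t Ht); auto_derive; [trivial|ring].
- intros t _; exact (is_derive_continuous _ _ _ (is_derive_value t)).
- intros t _; apply (continuous_scal_r k (fun t => t) t), continuous_id.
Qed.

Lemma value_left (x : R) : x <= a -> value x = qu * (a - x) + value a.
Proof.
intros Hx; pose proof (value_affine (- qu) x a Hx) as E.
assert (value a - value x = - qu * a - - qu * x)
  by (apply E; intros t Ht; apply marginal_ext_left; lra).
lra.
Qed.

Lemma value_right (x : R) : b <= x -> value x = qd * (x - b) + value b.
Proof.
intros Hx; pose proof (value_affine qd b x Hx) as E.
assert (value x - value b = qd * x - qd * b)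
  by (apply E; intros t Ht; apply marginal_ext_right; lra).
lra.
Qed.

Lemma value_ge0 (x : R) : 0 <= value x.
Proof.
assert (Hmid : forall x, a <= x <= b -> 0 <= value x).
{ intros y Hy.
  enough (value a - - qu * a <= value y - - qu * y)
    by (rewrite value_a in *; nra).
  apply (derive_ge0_nondecreasing (fun t => value t - - qu * t)
           (fun t => marginal_ext t - - qu)); [|lra|].
  - intros t; apply (is_derive_minus value (fun t => - qu * t) t);
      [apply is_derive_value|auto_derive; [trivial|ring]].
  - intros t Ht; rewrite marginal_ext_mid by lra.
    destruct (marginal_bounds (marginal t) t); [lra| |lra].
    unfold marginal; field; apply g_neq0. }
destruct (Rle_or_lt x a) as [Hx|Hx].
- rewrite value_left by exact Hx; pose proof (Hmid a); nra.
- destruct (Rle_or_lt b x) as [Hx'|Hx'].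
  + rewrite value_right by exact Hx'; pose proof (Hmid b); nra.
  + apply Hmid; lra.
Qed.

Lemma value_solves : solves_free_boundary_problem mu sigma c qu qd a b value l.
Proof.
assert (E1 : forall x, Derive value x = marginal_ext x)
  by (intros x; apply is_derive_unique, is_derive_value).
assert (E2 : forall x, Derive (Derive value) x = marginal2_ext x).
{ intros x; rewrite (Derive_ext _ _ x E1).
  apply is_derive_unique, is_derive_marginal_ext. }
split; [|split; [exact value_ge0|split; [exact level_ge0|split; [|split]]]].
- intros x; split; [|split].
  + eexists; apply is_derive_value.
  + eexists; apply is_derive_ext with marginal_ext; [now intros y|].
    apply is_derive_marginal_ext.
  + apply continuous_ext with marginal2_ext; [now intros y|].
    apply continuous_marginal2_ext.
- intros x Hx; unfold generator; rewrite E2, E1; unfold marginal2_ext.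
  rewrite clamp_id, marginal_ext_mid by lra; apply marginal_ode.
- exact value_right.
- exact value_left.
Qed.

End FreeBoundary.

End OptimalBoundaries.

(** * Scale and speed densities, and the integrals expressed by their primitives *)

Section ScaleAndSpeed.

Context (mu sigma c : R -> R) (x0 : R).
Context (mu_continuous : forall x, continuous mu x).
Context (sigma_continuous : forall x, continuous sigma x).
Context (sigma2_gt0 : forall x, 0 < sigma x ^ 2).
Context (c_continuous : forall x, continuous c x).

Let g (x : R) : R := / scale_density mu sigma x0 x.
Let m : R -> R := speed_density mu sigma x0.

Lemma inv_scale_gt0 (x : R) : 0 < g x.
Proof. apply Rinv_0_lt_compat, exp_pos. Qed.

Lemma speed_density_inv_scale (x : R) : m x = 2 / sigma x ^ 2 * g x.
Proof.
unfold m, speed_density, g; field; split; [apply Rgt_not_eq, exp_pos|].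
intros Hs; pose proof (sigma2_gt0 x); rewrite Hs in *; lra.
Qed.

Lemma continuous_mult_inv_sigma2 (f : R -> R) (x : R) :
  continuous f x -> continuous (fun y => f y / sigma y ^ 2) x.
Proof.
intros Hf; apply (continuous_mult f (fun y => / sigma y ^ 2) x Hf).
apply continuous_Rinv_comp; [|apply Rgt_not_eq, sigma2_gt0].
(* The square unfolds to [sigma y * (sigma y * 1)], hence the factor 1. *)
apply (continuous_mult sigma (fun y => sigma y * 1) x); [apply sigma_continuous|].
apply (continuous_mult sigma (fun _ => 1) x); [apply sigma_continuous|].
apply continuous_const.
Qed.

Lemma is_derive_inv_scale (x : R) : is_derive g x (mu x * m x).
Proof.
apply is_derive_ext with
  (fun y => exp (RInt (fun y => 2 * mu y / sigma y ^ 2) x0 y)).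
{ intros y; unfold g, scale_density; rewrite <- exp_Ropp, Ropp_involutive; reflexivity. }
replace (mu x * m x) with (scal (2 * mu x / sigma x ^ 2)
  (exp (RInt (fun y => 2 * mu y / sigma y ^ 2) x0 x))).
- apply (is_derive_comp exp); [apply is_derive_exp|].
  apply (is_derive_RInt_continuous (fun y => 2 * mu y / sigma y ^ 2)); intros y.
  apply (continuous_mult_inv_sigma2 (fun y => 2 * mu y)).
  apply (continuous_scal_r 2 mu y (mu_continuous y)).
- rewrite speed_density_inv_scale; unfold g, scale_density.
  rewrite <- exp_Ropp, Ropp_involutive; unfold scal; simpl; unfold mult; simpl.
  unfold Rdiv; ring.
Qed.

Lemma speed_density_continuous (x : R) : continuous m x.
Proof.
apply continuous_ext with (fun y => 2 / sigma y ^ 2 * g y).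
{ intros y; symmetry; apply speed_density_inv_scale. }
apply (continuous_mult (fun y => 2 / sigma y ^ 2) g x).
- apply (continuous_mult_inv_sigma2 (fun _ => 2)), continuous_const.
- exact (is_derive_continuous _ _ _ (is_derive_inv_scale x)).
Qed.

Lemma cost_density_continuous (x : R) : continuous (fun t => c t * m t) x.
Proof.
apply (continuous_mult c m x); [apply c_continuous|apply speed_density_continuous].
Qed.

Definition speed_primitive (x : R) : R := RInt m 0 x.
Definition cost_primitive (x : R) : R := RInt (fun t => c t * m t) 0 x.

Lemma is_derive_speed_primitive (x : R) : is_derive speed_primitive x (m x).
Proof. apply is_derive_RInt_continuous, speed_density_continuous. Qed.

Lemma is_derive_cost_primitive (x : R) : is_derive cost_primitive x (c x * m x).
Proof.
exact (is_derive_RInt_continuous (fun t => c t * m t) 0 x cost_density_continuous).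
Qed.

Lemma speed_measure_primitive (a b : R) :
  speed_measure mu sigma x0 a b = speed_primitive b - speed_primitive a.
Proof.
apply RInt_is_derive; [apply is_derive_speed_primitive|apply speed_density_continuous].
Qed.

Lemma RInt_cost_primitive (a b : R) :
  RInt (fun t => c t * m t) a b = cost_primitive b - cost_primitive a.
Proof.
apply (RInt_is_derive cost_primitive);
  [apply is_derive_cost_primitive|apply cost_density_continuous].
Qed.

Lemma RInt_Phi (f : R -> R) (q l a b : R) :
  (forall x, f x = c x + q * mu x) ->
  RInt (fun t => (f t - l) * m t) a b
  = Phi g speed_primitive cost_primitive q l a
    - Phi g speed_primitive cost_primitive q l b.
Proof.
intros Hf.
rewrite (RInt_is_derive
  (fun x => - Phi g speed_primitive cost_primitive q l x)); [apply Rminus_diag_uniq; ring| |].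
- intros x.
  replace ((f x - l) * m x) with (- ((l - (c x + q * mu x)) * m x))
    by (rewrite Hf; ring).
  apply (is_derive_opp (Phi g speed_primitive cost_primitive q l) x).
  apply (Phi_derive mu c g m).
  + exact is_derive_inv_scale.
  + exact is_derive_speed_primitive.
  + exact is_derive_cost_primitive.
- intros x; apply (continuous_mult (fun t => f t - l) m x);
    [|apply speed_density_continuous].
  apply continuous_ext with (fun t => c t + q * mu t - l).
  { intros y; now rewrite Hf. }
  apply (continuous_minus (fun t => c t + q * mu t) (fun _ => l) x);
    [|apply continuous_const].
  apply (continuous_plus c (fun t => q * mu t) x); [apply c_continuous|].
  apply (continuous_scal_r q mu x (mu_continuous x)).
Qed.

Lemma I1_gain (qu qd a b : R) :
  I1 mu sigma c qu qd x0 a b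
  = - gain g speed_primitive cost_primitive qu qd (pi1 mu c qd b) a b.
Proof.
unfold I1; fold m; rewrite (RInt_Phi (pi1 mu c qd) qd) by reflexivity.
unfold Rdiv; fold (g a); unfold gain, Phi; ring.
Qed.

Lemma I2_gain (qu qd a b : R) :
  I2 mu sigma c qu qd x0 a b
  = - gain g speed_primitive cost_primitive qu qd (pi2 mu c qu a) a b.
Proof.
unfold I2; fold m; rewrite (RInt_Phi (pi2 mu c qu) (- qu))
  by (intros x; unfold pi2; ring).
unfold Rdiv; fold (g b); unfold gain, Phi; ring.
Qed.

Lemma average_cost_gain (qu qd l a b : R) :
  speed_primitive a < speed_primitive b ->
  gain g speed_primitive cost_primitive qu qd l a b = 0 ->
  average_cost mu sigma c qu qd x0 a b = l.
Proof.
intros HM Hg; unfold average_cost; fold m.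
rewrite speed_measure_primitive, RInt_cost_primitive.
unfold Rdiv; fold (g a) (g b); unfold gain, Phi in Hg.
apply Rmult_eq_reg_l with (speed_primitive b - speed_primitive a); [|lra].
rewrite <- Rmult_assoc, Rinv_r by lra; lra.
Qed.

End ScaleAndSpeed.

Theorem theorem2p3
  (mu sigma c : R -> R) (qu qd x0 xhat1 xhat2 : R)
  (mu_continuous : forall x, continuous mu x)
  (sigma_continuous : forall x, continuous sigma x)
  (sigma_ge0 : forall x, 0 <= sigma x)
  (sigma2_gt0 : forall x, 0 < (sigma x) ^ 2)
  (locally_integrable : forall l r,
     ex_RInt (fun x => (1 + Rabs (mu x)) / (sigma x) ^ 2) l r)
  (c_continuous : forall x, continuous c x)
  (c0_ge0 : 0 <= c 0)
  (c_min : forall x, c 0 <= c x)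
  (qu_ge0 : 0 <= qu) (qd_ge0 : 0 <= qd) (q_gt0 : 0 < qu + qd)
  (pi1_argmin : is_unique_argmin (pi1 mu c qd) xhat1)
  (pi1_monotone : decreasing_then_increasing (pi1 mu c qd) xhat1)
  (pi2_argmin : is_unique_argmin (pi2 mu c qu) xhat2)
  (pi2_monotone : decreasing_then_increasing (pi2 mu c qu) xhat2)
  (pi1_lim : is_lim (pi1 mu c qd) p_infty p_infty)
  (pi2_lim : is_lim (pi2 mu c qu) m_infty p_infty) :
  (exists! p : R * R,
     optimal_boundaries mu sigma c qu qd x0 xhat1 xhat2 (fst p) (snd p)) /\
  (forall a b : R,
     optimal_boundaries mu sigma c qu qd x0 xhat1 xhat2 a b ->
     (exists (v : R -> R) (lambda : R),
        solves_free_boundary_problem mu sigma c qu qd a b v lambda) /\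
     (forall (v : R -> R) (lambda : R),
        solves_free_boundary_problem mu sigma c qu qd a b v lambda ->
        average_cost mu sigma c qu qd x0 a b = lambda /\
        lambda = pi2 mu c qu a /\
        pi2 mu c qu a = pi1 mu c qd b /\
        (forall x, - qu <= Derive v x <= qd))).
Proof.
set (g := fun x => / scale_density mu sigma x0 x).
set (m := speed_density mu sigma x0).
set (M := speed_primitive mu sigma x0).
set (C := cost_primitive mu sigma c x0).
assert (Hm : forall x, m x = 2 / sigma x ^ 2 * g x)
  by (intros x; now apply speed_density_inv_scale).
assert (Hmc : forall x, continuous m x)
  by (intros x; now apply speed_density_continuous).
assert (Hg0 : forall x, 0 < g x) by (intros x; apply inv_scale_gt0).
assert (Hg : forall x, is_derive g x (mu x * m x))
  by (intros x; now apply is_derive_inv_scale).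
assert (HM : forall x, is_derive M x (m x))
  by (intros x; now apply is_derive_speed_primitive).
assert (HC : forall x, is_derive C x (c x * m x))
  by (intros x; now apply is_derive_cost_primitive).
assert (Hc : forall x, 0 <= c x) by (intros x; specialize (c_min x); lra).
pose proof (argmin_unimodal _ _ pi1_argmin pi1_monotone) as U1.
pose proof (argmin_unimodal _ _ pi2_argmin pi2_monotone) as U2.
assert (Mincr : forall x y, x < y -> M x < M y) by (eapply M_increasing with (m := m); eauto).
(* The two integral conditions are traded for one level [l] that is common to both boundaries and
   has zero gain. *)
assert (Hopt : forall a b,
  optimal_boundaries mu sigma c qu qd x0 xhat1 xhat2 a b <->
  exists l, stationary mu c qu qd xhat1 xhat2 l a b /\
    a < xhat2 /\ xhat1 < b /\ a < b /\ gain g M C qu qd l a b = 0).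
{ intros a b; unfold optimal_boundaries.
  rewrite I1_gain, I2_gain by assumption; fold g M C; split.
  - intros (Ha & Hb & Hab & E1 & E2); exists (pi2 mu c qu a).
    (* The gain of the same pair vanishes at the levels [pi1 b] and [pi2 a]; being affine in the
       level with positive slope, it has only one zero. *)
    assert (E : pi1 mu c qd b = pi2 mu c qu a).
    { specialize (Mincr a b Hab); unfold gain, Phi in E1, E2.
      apply Rmult_eq_reg_r with (M b - M a); lra. }
    unfold stationary; repeat split; try lra; exact E.
  - intros (l & (_ & _ & E2 & E1) & Ha & Hb & Hab & E).
    rewrite E1, E2; repeat split; lra. }
split.
- destruct (stationary_gain_zero_exists mu sigma c g m M C qu qd xhat1 xhat2)
    as (l & a & b & H); try assumption.
  exists (a, b); split; [apply Hopt; now exists l|].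
  intros [a' b'] H'; apply Hopt in H'; simpl in H'.
  destruct H' as (l' & Hs' & _ & _ & Hab' & E'), H as (Hs & _ & _ & Hab & E).
  assert (a = a' /\ b = b') as [-> ->]
    by (eapply stationary_gain_zero_unique with (m := m) (l := l) (l' := l'); eauto).
  reflexivity.
- intros a b H; apply Hopt in H; destruct H as (l & Hs & _ & _ & Hab & E).
  split.
  + exists (value mu c g m M C qu l a b), l.
    eapply value_solves; eauto.
  + intros v lambda Hv.
    assert (lambda = l) as -> by (eapply solution_lambda with (m := m); eauto).
    assert (E2 : pi2 mu c qu a = l) by apply Hs.
    assert (E1 : pi1 mu c qd b = l) by apply Hs.
    rewrite E1, E2; split; [|split; [reflexivity|split; [reflexivity|]]].
    * apply average_cost_gain; auto.
    * intros x; eapply solution_marginal_bounds with (m := m); eauto.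
Qed.
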